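(* Let $X$ be a graph which is self-similar with respect to $F$, with isomorphism $\psi:X\to X_F$ and $\phi=\psi^{-1}$. Then for every $n\ge1$, $X$ is also self-similar with respect to $F^n$. Moreover, exactly one of the following holds: either there exists exactly one origin cell $O$, and for every cell $C$ there is an integer $n$ with $\phi_S^n C=O$; or $\phi$ has exactly one origin vertex, and for every cell $C$ there exist a periodic origin cell $O_m$ with some period $m$ and an integer $n$ with $\phi_S^nC=O_m$.
   Context: Graphs are connected, locally finite, infinite, undirected, without loops or multiple edges; $d_X$ is the graph metric. For $C\subseteq VX$, $\theta C$ is the set of vertices of $VX\setminus C$ adjacent to a vertex of $C$, $\overline C=C\cup\theta C$. For $F\subseteq VX$, $\mathcal{C}_X(F)$ is the set of connected components (as vertex sets) of the subgraph induced on $VX\setminus F$. The reduced graph $X_F$ has vertex set $F$, distinct $x,y$ adjacent iff $x,y\in\theta C$ for some $C\in\mathcal{C}_X(F)$. $X$ is self-similar with respect to $F$ if (F1) no two vertices of $F$ are adjacent in $X$, (F2) distinct $C,D\in\mathcal{C}_X(F)$ satisfy $|\overline C\cap\overline D|\le1$, (F3) there is a graph isomorphism $\psi:X\to X_F$. Put $\phi=\psi^{-1}:F\to VX$, $F^0=VX$, $F^n=\psi^n(VX)$ (so $F^1=F$). Elements of $\mathcal{C}_X(F^n)$ are $n$-cells; 1-cells are cells. For a cell $C$, $S(C)$ is the 2-cell containing $C$, and $\phi_S(C)$ is the cell whose boundary is $\phi(\theta S(C))$ (equivalently $\phi_S(C)=\phi(S(C)\cap F)$). A cell $C$ with $\phi_SC=C$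 is an origin cell; a fixed point of $\phi$ is an origin vertex; a cell with $\phi_S^mC=C$ is a periodic origin cell with period $m$.
   Formalization: The ''moreover'' part assumes that φ_S(C)=φ(S(C)∩F) is a cell with boundary φ(θS(C)) for each cell C; at least one alternative then holds, and they exclude each other if no origin vertex lies on the boundary of exactly one cell (otherwise both can hold, e.g. the half-line). *)

(* Defs.v *)
From Stdlib Require Import Relation_Operators.
From mathcomp Require Import all_boot.
From mathcomp Require Import boolp classical_sets functions cardinality.

Set Implicit Arguments.
Unset Strict Implicit.
Unset Printing Implicit Defensive.

Local Open Scope classical_set_scope.

Record graph := Graph {
  vertex :> Type;
  adj : vertex -> vertex -> Prop;
  adj_sym : forall x y, adj x y -> adj y x;
  adj_irrefl : forall x, ~ adj x x
}.

Section Graphs.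
Variable X : graph.
Implicit Types (A C D F : set X) (x y : X).

Definition walk_in A : X -> X -> Prop :=
  clos_refl_trans X (fun x y => [/\ A x, A y & adj x y]).

Definition connected_graph : Prop := forall x y, walk_in [set: X] x y.

Definition locally_finite : Prop := forall x, finite_set [set y | adj x y].

Definition boundary C : set X :=
  [set y | ~ C y /\ exists2 x, C x & adj x y].

Definition vclosure C : set X := C `|` boundary C.

(* C_X(F); the reflexive case of [walk_in] is why [x] must lie outside F. *)
Definition components F : set (set X) :=
  [set C | exists2 x, ~ F x & C = [set y | walk_in (~` F) x y]].

Definition reduced_adj F (x y : F) : Prop :=
  x <> y /\ exists2 C, components F C &
    boundary C (sval x) /\ boundary C (sval y).

Lemma reduced_adj_sym F (x y : F) : reduced_adj x y -> reduced_adj y x.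
Proof.
by move=> [nxy [C cC [bx by_]]]; split=> [e|]; [exact/nxy/esym|exists C].
Qed.

Lemma reduced_adj_irrefl F (x : F) : ~ reduced_adj x x.
Proof. by case. Qed.

Definition reduced F : graph :=
  Graph (@reduced_adj_sym F) (@reduced_adj_irrefl F).

End Graphs.

Definition graph_iso (X Y : graph) (f : X -> Y) : Prop :=
  bijective f /\ forall x y, adj x y <-> adj (f x) (f y).

Definition self_similar_by (X : graph) (F : set X) (psi : X -> reduced F) :=
  [/\ forall x y, F x -> F y -> ~ adj x y,
      forall C D, components F C -> components F D -> C <> D ->
        is_subset1 (vclosure C `&` vclosure D)
    & graph_iso psi].

Definition self_similar (X : graph) (F : set X) : Prop :=
  exists psi : X -> reduced F, self_similar_by psi.

Section Origins.
Variables (X : graph) (F : set X) (psi : X -> reduced F) (phi : reduced F -> X).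
Implicit Types (A C O : set X).

(* F^n = psi^n(VX), with psi read as a map from VX into itself. *)
Definition Fpow (n : nat) : set X := range (iter n (fun x => sval (psi x))).

(* phi(A `&` F) *)
Definition phi_image A : set X := phi @` [set x : reduced F | A (sval x)].

Definition cell : set (set X) := components F.

(* S(C); for a cell C there is exactly one such 2-cell. *)
Definition supercell C : set X :=
  xget set0 [set D | components (Fpow 2) D /\ C `<=` D].

(* phi(S(C) `&` F). This is a cell, with boundary phi(theta S(C)), as soon as
   S(C) meets F. Axioms F1-F3 allow S(C) to miss F: C may have a single
   boundary vertex, lying in F^2, and then S(C) = C. *)
Definition phiS C : set X := phi_image (supercell C).

Definition origin_cell O : Prop := cell O /\ phiS O = O.

Definition periodic_origin_cell (m : nat) O : Prop :=
  [/\ cell O, 0 < m & iter m phiS O = O].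

Definition origin_vertex (x : reduced F) : Prop := phi x = sval x.

(* The next two properties can hold together: take the half-line on nat with
   psi x = 2x, where 0 is the origin vertex and {1} the only origin cell. *)
Definition one_origin_cell : Prop :=
  exists O, unique origin_cell O /\
    forall C, cell C -> exists n, iter n phiS C = O.

Definition one_origin_vertex : Prop :=
  (exists! x, origin_vertex x) /\
  forall C, cell C -> exists m O n,
    periodic_origin_cell m O /\ iter n phiS C = O.

End Origins.

(* Main.v *)
(** Write [g] for [psi] as a self-map of X. A walk outside [g @` G] is recorded
    by its visits to [F], so components of X minus G and of X minus [g @` G]
    correspond, except for cells with a single boundary vertex; this lifts
    self-similarity from F^n to F^(n+1).

    Call two cells touching when they share a boundary vertex. [phi] maps the
    boundary of a cell to a clique of X and F is independent, so [phiS] turns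
    chains of 2k touching cells into chains of k. The graph of touching cells is
    connected and locally finite, hence every orbit of [phiS] is finite and any
    two periodic cells touch. If there is only one periodic cell, it is the
    origin cell; otherwise the vertex shared by two of them leads to a fixed
    vertex of [phi], unique by contraction. Finally, [phiS] maps the finite set
    of cells at an origin vertex onto itself; if they all reach a single origin
    cell, that cell is the only one. *)
From Stdlib Require Import Relation_Operators Operators_Properties.
Require Import Defs.
From mathcomp Require Import all_boot.
From mathcomp Require Import boolp classical_sets functions cardinality.

Set Implicit Arguments.
Unset Strict Implicit.
Unset Printing Implicit Defensive.

Local Open Scope classical_set_scope.

(** * Walks, connected components and their boundaries *)

Section Components.
Variable X : graph.
Implicit Types (A C D F G : set X) (x y z : X).

Definition component F x : set X := [set y | walk_in (~` F) x y].

Lemma walk_refl A x : walk_in A x x.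
Proof. exact: rt_refl. Qed.

Lemma walk_trans A x y z : walk_in A x y -> walk_in A y z -> walk_in A x z.
Proof. exact: rt_trans. Qed.

Lemma walk_step A x y : A x -> A y -> adj x y -> walk_in A x y.
Proof. by move=> Ax Ay xy; apply: rt_step. Qed.

Lemma walk_sym A x y : walk_in A x y -> walk_in A y x.
Proof.
elim=> {x y} [x y [Ax Ay xy]|x|x y z _ yx _ zy].
- by apply: walk_step => //; apply: adj_sym.
- exact: walk_refl.
- exact: walk_trans zy yx.
Qed.

Lemma walk_mono A A' x y : A `<=` A' -> walk_in A x y -> walk_in A' x y.
Proof.
move=> sAA'; elim=> {x y} [x y [Ax Ay xy]|x|x y z _ xy _ yz].
- by apply: walk_step => //; apply: sAA'.
- exact: walk_refl.
- exact: walk_trans xy yz.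
Qed.

Lemma walk_end A x y : walk_in A x y -> A x -> A y.
Proof. by elim=> {x y} [x y []|x|x y z _ xy _ yz] // /xy. Qed.

Lemma walk_ind A x (P : X -> Prop) :
    P x ->
    (forall y z, walk_in A x y -> P y -> A y -> A z -> adj y z -> P z) ->
  forall y, walk_in A x y -> P y.
Proof.
move=> Px Pstep y /(clos_rt_rtn1 X); elim=> // {}y z [Ay Az yz] xy Py.
exact: Pstep (clos_rtn1_rt _ _ _ _ xy) Py Ay Az yz.
Qed.

Lemma component_refl F x : component F x x.
Proof. exact: walk_refl. Qed.

Lemma component_eq F x y : component F x y -> component F y = component F x.
Proof.
move=> xy; apply/seteqP; split=> z; first exact: walk_trans.
by apply: walk_trans; apply: walk_sym.
Qed.

Lemma components_component F x : ~ F x -> components F (component F x).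
Proof. by exists x. Qed.

Lemma componentsE F C x : components F C -> C x -> C = component F x.
Proof. by move=> [y nFy ->] /component_eq. Qed.

Lemma components_avoid F C x : components F C -> C x -> ~ F x.
Proof. by move=> [y nFy ->] /walk_end; apply. Qed.

Lemma components_nonempty F C : components F C -> exists x, C x.
Proof. by move=> [x nFx ->]; exists x; exact: walk_refl. Qed.

Lemma components_step F C x y :
  components F C -> C x -> adj x y -> ~ F y -> C y.
Proof.
move=> cC Cx xy nFy; rewrite (componentsE cC Cx); apply: walk_step => //.
exact: components_avoid cC Cx.
Qed.

Lemma boundary_sub F C : components F C -> boundary C `<=` F.
Proof.
move=> cC y [nCy [x Cx xy]]; apply: contrapT => nFy.
by apply: nCy; apply: components_step cC Cx xy nFy.
Qed.

Lemma boundary_step F C x y :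
  components F C -> C x -> adj x y -> F y -> boundary C y.
Proof.
move=> cC Cx xy Fy; split; last by exists x.
by move=> /(components_avoid cC).
Qed.

Lemma components_disjoint F C D x :
  components F C -> components F D -> C x -> D x -> C = D.
Proof.
by move=> cC cD Cx Dx; rewrite (componentsE cC Cx) (componentsE cD Dx).
Qed.

Lemma vclosure_boundary F C D x : components F C -> components F D ->
  C <> D -> vclosure C x -> vclosure D x -> boundary C x /\ boundary D x.
Proof.
move=> cC cD nCD [Cx|bCx] [Dx|bDx] //.
- by case: nCD; apply: components_disjoint cC cD Cx Dx.
- by case: (components_avoid cC Cx); apply: boundary_sub cD _ bDx.
- by case: (components_avoid cD Dx); apply: boundary_sub cC _ bCx.
Qed.

(** Only the last step leaves [C], so [F] is met at most at the end [y]. Such walks replace edges of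
    the reduced graph. *)
Lemma walk_boundary F G C x y : components F C -> G `<=` F ->
  C x -> boundary C y -> ~ G y -> walk_in (~` G) x y.
Proof.
move=> cC sGF Cx [nCy [z Cz zy]] nGy.
have nG w : C w -> ~ G w by move=> Cw /sGF; apply: components_avoid cC Cw.
apply: (@walk_trans _ _ z); last by apply: walk_step => //; apply: nG.
move: Cz; rewrite (componentsE cC Cx); apply: walk_mono => w nFw /sGF.
exact: nFw.
Qed.

Lemma boundary_nonempty F C : connected_graph X -> F !=set0 ->
  components F C -> boundary C !=set0.
Proof.
move=> cX [f Ff] cC; have [x Cx] := components_nonempty cC.
apply: contrapT => nb; apply: (components_avoid cC _ Ff).
apply: walk_ind (cX x f) => // y z _ Cy _ _ yz; apply: contrapT => nCz.
by apply: nb; exists z; split=> //; exists y.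
Qed.

End Components.

(** * Transfer of components along [g] *)

Section SelfSimilar.
Variables (X : graph) (F : set X) (g : X -> X).
Implicit Types (C D G : set X) (x y z : X).
Hypothesis g_inj : injective g.
Hypothesis FE : F = range g.
Hypothesis F_indep : forall x y, F x -> F y -> ~ adj x y.
Hypothesis adjP : forall x y, adj x y <-> x <> y /\
  exists2 C, components F C & boundary C (g x) /\ boundary C (g y).

Let Fg x : F (g x). Proof. by rewrite FE; exists x. Qed.

Let F_range x : F x -> exists z, g z = x.
Proof. by rewrite FE => -[z _ <-]; exists z. Qed.

Lemma boundary_adj C x y : components F C ->
  boundary C (g x) -> boundary C (g y) -> x = y \/ adj x y.
Proof.
move=> cC bx by_; have [|nxy] := pselect (x = y); first by left.
by right; apply/adjP; split=> //; exists C.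
Qed.

Lemma notin_image G x : ~ G x -> ~ (g @` G) (g x).
Proof. by move=> nGx [y Gy /g_inj eyx]; apply: nGx; rewrite -eyx. Qed.

Let image_subF G : g @` G `<=` F.
Proof. by move=> _ [y _ <-]. Qed.

(** Each edge [x y] becomes a detour from [g x] to [g y] through a cell with both on its
    boundary. *)
Lemma walk_lift G x y : walk_in (~` G) x y -> walk_in (~` (g @` G)) (g x) (g y).
Proof.
elim=> {x y} [x y [nGx nGy /adjP[_ [C cC [bx by_]]]]|x|x y z _ xy _ yz].
- have [c Cc] := components_nonempty cC.
  apply: (@walk_trans _ _ _ c); first apply: walk_sym.
    by apply: walk_boundary cC _ Cc bx _ => //; apply: notin_image.
  by apply: walk_boundary cC _ Cc by_ _ => //; apply: notin_image.
- exact: walk_refl.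
- exact: walk_trans xy yz.
Qed.

(* A walk outside [g @` G] is read off at its visits to F: two consecutive
   visits lie on the boundary of one cell. *)
Lemma walk_drop G x u : ~ G x -> walk_in (~` (g @` G)) (g x) u ->
  (forall z, u = g z -> walk_in (~` G) x z) /\
  (~ F u -> exists2 z, walk_in (~` G) x z & boundary (component F u) (g z)).
Proof.
move=> nGx; move: u; apply: walk_ind.
  by split=> [z /g_inj <-|/(_ (Fg x))//]; exact: walk_refl.
move=> u v _ [uF uC] nGu nGv uv; have [Fu|nFu] := pselect (F u).
  have nFv : ~ F v by move=> Fv; apply: F_indep uv.
  split=> [z ev|_]; first by case: nFv; rewrite ev.
  have [z ez] := F_range Fu; exists z; first exact: uF.
  apply: boundary_step (components_component nFv) (component_refl F v) _ (Fg z).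
  by rewrite ez; apply: adj_sym.
(* The invariant puts [g z] on the boundary of the cell of [u]; if [v = g w] is there too, [z] and
   [w] are equal or adjacent. *)
have [z xz bz] := uC nFu; split=> [w ev|nFv]; last first.
  exists z => //; suff -> : component F v = component F u by [].
  by apply: component_eq; apply: walk_step.
have bw : boundary (component F u) (g w).
  apply: boundary_step (components_component nFu) (component_refl F u) _ (Fg w).
  by rewrite -ev.
case: (boundary_adj (components_component nFu) bz bw) => [<-//|zw].
apply: (walk_trans xz); apply: walk_step => //; first exact: walk_end xz nGx.
by move=> Gw; apply: nGv; rewrite ev; exists w.
Qed.

Lemma component_lift G x : ~ G x ->
  (forall z, component (g @` G) (g x) (g z) <-> component G x z) /\
  boundary (component (g @` G) (g x)) = g @` boundary (component G x).
Proof.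
move=> nGx; have nGgx := notin_image nGx.
have cD := components_component nGgx; have cD' := components_component nGx.
split=> [z|]; first by split=> [/(walk_drop nGx)[/(_ z erefl)]|/walk_lift].
apply/seteqP; split=> [y by_|_ [y by_ <-]].
  have [_ [c Dc cy]] := by_.
  have [z Gz ez] : (g @` G) y by apply: boundary_sub cD _ by_.
  have nFc : ~ F c by move=> Fc; apply: F_indep cy => //; rewrite -ez.
  have [_ /(_ nFc)[w xw bw]] := walk_drop nGx Dc.
  exists z => //; apply: (boundary_step cD' xw _ Gz).
  have cC := components_component nFc.
  have bz : boundary (component F c) (g z).
    by apply: boundary_step cC (component_refl F c) _ (Fg z); rewrite ez.
  case: (boundary_adj cC bw bz) => // ewz.
  by case: (walk_end xw nGx); rewrite ewz.
(* Conversely, the edge from [d] to [y] comes from a cell [C], whose vertex [c] next to [g y] is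
   reached from [g d] inside [C]. *)
have Gy := boundary_sub cD' by_.
have [_ [d xd /adjP[_ [C cC [bd b_y]]]]] := by_.
have [_ [c Cc cy]] := b_y.
have nGd := walk_end xd nGx.
apply: boundary_step cD _ cy _; last by exists y.
apply: walk_trans (walk_lift xd) _; apply: walk_sym.
by apply: walk_boundary cC _ Cc bd _ => //; apply: notin_image.
Qed.

Lemma components_lift G D : components G D -> exists D2,
  [/\ components (g @` G) D2, forall z, D2 (g z) <-> D z
    & boundary D2 = g @` boundary D].
Proof.
move=> [x nGx ->]; exists (component (g @` G) (g x)).
have [? ?] := component_lift nGx.
by split=> //; apply/components_component/notin_image.
Qed.

(** A component that misses [F] is itself a cell, so two of its boundary vertices come from equal or
    adjacent vertices of [G], which is independent. Any other component is a lift. *)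
Lemma components_drop G D : (forall x y, G x -> G y -> ~ adj x y) ->
  components (g @` G) D -> is_subset1 (boundary D) \/
  exists D', [/\ components G D', forall z, D (g z) <-> D' z
    & boundary D = g @` boundary D'].
Proof.
move=> G_indep cD; have [[x Dx]|nD] := pselect (exists x, D (g x)).
  right; have nGx : ~ G x.
    by move=> Gx; apply: (components_avoid cD Dx); exists x.
  exists (component G x); rewrite (componentsE cD Dx).
  by have [? ?] := component_lift nGx; split=> //; apply: components_component.
left; have nDF y : D y -> ~ F y.
  by move=> Dy /F_range[x exy]; apply: nD; exists x; rewrite exy.
have [d Dd] := components_nonempty cD.
have cFD : components F D.
  exists d; first exact: nDF.
  rewrite {1}(componentsE cD Dd); apply/seteqP; split=> y; last first.
    by apply: walk_mono => z nFz /image_subF.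
  apply: walk_ind => [|u v du Fdu nu nv uv]; first exact: walk_refl.
  apply: walk_trans Fdu _; apply: walk_step => //.
    by apply: nDF; rewrite (componentsE cD Dd).
  apply: nDF; rewrite (componentsE cD Dd); apply: walk_trans du _.
  exact: walk_step.
move=> x y bx by_.
move: (boundary_sub cD bx) (boundary_sub cD by_) => [u Gu eu] [v Gv ev].
rewrite -eu -ev in bx by_ *.
by case: (boundary_adj cFD bx by_) => [->//|/(G_indep _ _ Gu Gv)].
Qed.

(** * Self-similarity with respect to the iterated ranges of [g] *)

Hypothesis F_meet : forall C D, components F C -> components F D -> C <> D ->
  is_subset1 (vclosure C `&` vclosure D).

Lemma range_iterS n : range (iter n.+1 g) = g @` range (iter n g).
Proof. by rewrite image_comp. Qed.

Lemma iter_inj n : injective (iter n g).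
Proof. by elim: n => [//|n IHn] x y /g_inj/IHn. Qed.

(** In the induction F1 is inherited from [F], while F2 and the adjacency criterion are carried by
    [components_drop] and [components_lift]. *)
Lemma range_iter_self_similar n (G := range (iter n.+1 g)) :
  [/\ forall x y, G x -> G y -> ~ adj x y,
      forall C D, components G C -> components G D -> C <> D ->
        is_subset1 (vclosure C `&` vclosure D)
    & forall x y, adj x y <-> x <> y /\ exists2 C, components G C &
        boundary C (iter n.+1 g x) /\ boundary C (iter n.+1 g y)].
Proof.
rewrite {}/G; elim: n => [|n [G_indep G_meet G_adjP]].
  have -> : range (iter 1 g) = F by rewrite FE.
  by split; [exact: F_indep|exact: F_meet|exact: adjP].
rewrite range_iterS.
split=> [x y /image_subF Fx /image_subF Fy|C D cC cD nCD|x y].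
- exact: F_indep.
- move=> x y [Cx Dx] [Cy Dy].
  have [bCx bDx] := vclosure_boundary cC cD nCD Cx Dx.
  have [bCy bDy] := vclosure_boundary cC cD nCD Cy Dy.
  have [|[C' [cC' gC' bC']]] := components_drop G_indep cC; first exact.
  have [|[D' [cD' gD' bD']]] := components_drop G_indep cD; first exact.
  have nCD' : C' <> D'.
    move=> eCD'; apply: nCD; have [z Cz] := components_nonempty cC'.
    apply: (components_disjoint cC cD (x := g z)); first exact/gC'.
    by apply/gD'; rewrite -eCD'.
  move: bCx bDx bCy bDy; rewrite bC' bD' => -[u bCu <-] [? bDu /g_inj eu].
  move=> [v bCv <-] [? bDv /g_inj ev]; rewrite eu in bDu; rewrite ev in bDv.
  congr g.
  by apply: (G_meet _ _ cC' cD' nCD'); split; right.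
- split=> [/G_adjP[nxy [C cC [bx by_]]]|[nxy [C cC [bx by_]]]].
    split=> //; have [C2 [cC2 _ bC2]] := components_lift cC.
    exists C2 => //; rewrite bC2.
    by split; [exists (iter n.+1 g x)|exists (iter n.+1 g y)].
  have [/(_ _ _ bx by_)/iter_inj//|[C' [cC' _ bC']]] :=
    components_drop G_indep cC.
  apply/G_adjP; split=> //; exists C' => //.
  move: bx by_; rewrite bC' => -[u bu /g_inj eu] [v bv /g_inj ev].
  by rewrite eu in bu; rewrite ev in bv.
Qed.

(** * The graph of touching cells *)

Hypothesis X_connected : connected_graph X.
Hypothesis X_locally_finite : locally_finite X.
Hypothesis X_infinite : infinite_set [set: X].

Definition touch C D := exists2 v, boundary C v & boundary D v.

(** As [touch] is reflexive on cells, [near k] between cells means distance at most [k]. *)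
Fixpoint near k C D : Prop :=
  if k is k'.+1 then exists E, [/\ components F E, touch C E & near k' E D]
  else C = D.

Lemma cell_boundary_nonempty C : components F C -> boundary C !=set0.
Proof.
move=> cC; apply: (boundary_nonempty X_connected _ cC).
by have [x _] := components_nonempty cC; exists (g x).
Qed.

Lemma touch_refl C : components F C -> touch C C.
Proof. by move=> /cell_boundary_nonempty[v bv]; exists v. Qed.

Lemma touch_vclosure C D x : components F C -> components F D ->
  vclosure C x -> vclosure D x -> touch C D.
Proof.
move=> cC cD Cx Dx; have [<-|nCD] := pselect (C = D); first exact: touch_refl.
by have [bC bD] := vclosure_boundary cC cD nCD Cx Dx; exists x.
Qed.

Lemma near_trans k l C D E : near k C D -> near l D E -> near (k + l) C E.
Proof.
elim: k C => [|k IHk] C; first by move=> /= ->.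
by move=> /= [A [cA CA AD]] DE; exists A; split=> //; apply: IHk.
Qed.

Lemma near_refl k C : components F C -> near k C C.
Proof.
by move=> cC; elim: k => //= k IHk; exists C; split=> //; apply: touch_refl.
Qed.

Lemma near_mono k l C D : components F C -> k <= l -> near k C D -> near l C D.
Proof.
move=> cC kl CD; rewrite -(subnK kl).
by apply: near_trans CD; apply: near_refl.
Qed.

Lemma near_connected C D : components F C -> components F D ->
  exists k, near k C D.
Proof.
move=> cC cD; have [x Cx] := components_nonempty cC.
have [y Dy] := components_nonempty cD.
(* Closures replace cells here because the walk may stop at a vertex of [F]. *)
suff : forall E, components F E -> vclosure E y -> exists k, near k C E.
  by apply=> //; left.
move: y (X_connected x y) {D cD Dy}; apply: walk_ind.
  move=> D cD Dx; exists 1; exists D; split=> //.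
  by apply: touch_vclosure Dx => //; left.
move=> y z _ IHy _ _ yz D cD Dz; have [Fy|nFy] := pselect (F y).
  apply: IHy => //; right.
  case: Dz => [Dz|/(boundary_sub cD) Fz]; last by case: (F_indep Fy Fz yz).
  exact: boundary_step cD Dz (adj_sym yz) Fy.
have cE := components_component nFy.
have [|k CE] := IHy _ cE; first by left; exact: component_refl.
exists (k + 1); apply: near_trans CE _; exists D; split=> //.
apply: touch_vclosure Dz => //; have [Fz|nFz] := pselect (F z).
  by right; apply: boundary_step cE (component_refl F y) yz Fz.
by left; apply: walk_step.
Qed.

(** Pulled back by [g], the boundary is a clique, so it lies in the closed neighbourhood of one
    vertex. *)
Lemma cell_boundary_finite C : components F C -> finite_set (boundary C).
Proof.
move=> cC; have [v bv] := cell_boundary_nonempty cC.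
have [x ev] := F_range (boundary_sub cC bv); rewrite -{}ev in bv.
apply: (@sub_finite_set _ _ (g @` ([set x] `|` [set y | adj x y]))).
  move=> w bw; have [y ew] := F_range (boundary_sub cC bw).
  exists y => //; rewrite -ew in bw.
  by case: (boundary_adj cC bv bw) => [->|]; [left|right].
by apply: finite_image; rewrite finite_setU; split=> //; apply: finite_set1.
Qed.

Definition cells_at x : set (set X) := [set C | components F C /\ boundary C x].

Lemma cells_at_finite x : finite_set (cells_at x).
Proof.
apply: (@sub_finite_set _ _ (component F @` [set y | adj x y])).
  move=> C [cC [_ [y Cy yx]]]; exists y; first exact: adj_sym.
  by rewrite (componentsE cC Cy).
exact: finite_image.
Qed.

Lemma near_finite k C : components F C ->
  finite_set [set D | components F D /\ near k C D].
Proof.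
elim: k C => [|k IHk] C cC.
  by apply: (@sub_finite_set _ _ [set C]) => [D [_ ->]//|]; exact: finite_set1.
apply: (@sub_finite_set _ _
  (\bigcup_(E in \bigcup_(v in boundary C) cells_at v)
     [set D | components F D /\ near k E D])).
  by move=> D [cD [E [cE [v bC bE] ED]]]; exists E => //; exists v.
apply: bigcup_finite => [|E [v _ [cE _]]]; last exact: IHk.
apply: bigcup_finite => [|v _]; first exact: cell_boundary_finite.
exact: cells_at_finite.
Qed.

(* [T] is [phiS]; a boundary vertex [g w] of C is carried by [phi] to [w]. *)
Variable T : set X -> set X.
Hypothesis T_cell : forall C, components F C -> components F (T C).
Hypothesis T_vclosure : forall C w,
  components F C -> boundary C (g w) -> vclosure (T C) w.

(** * Contraction of chains of cells *)

Lemma iter_cell n C : components F C -> components F (iter n T C).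
Proof. by move=> cC; elim: n => //= n; apply: T_cell. Qed.

Lemma touchP C D : components F C -> components F D -> touch C D ->
  exists2 w, boundary C (g w) & boundary D (g w).
Proof.
move=> cC cD [v bC bD]; have [w ew] := F_range (boundary_sub cC bC).
by exists w; rewrite ew.
Qed.

Lemma vclosure_step C x y : components F C -> C x -> adj x y -> vclosure C y.
Proof.
move=> cC Cx xy; have [Fy|nFy] := pselect (F y); last first.
  by left; apply: components_step cC Cx xy nFy.
by right; apply: boundary_step cC Cx xy Fy.
Qed.

(* [phi] sends two boundary vertices of D to equal or adjacent vertices, of
   which at most one lies in F, so the other one is interior to its cell. *)
Lemma T_touch2 C D E : components F C -> components F D -> components F E ->
  touch C D -> touch D E -> touch (T C) (T E).
Proof.
move=> cC cD cE /touchP[]// v Cv Dv /touchP[]// w Dw Ew.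
have TCv := T_vclosure cC Cv; have TEw := T_vclosure cE Ew.
have [cTC cTE] := (T_cell cC, T_cell cE).
have [evw|vw] := boundary_adj cD Dv Dw.
  by rewrite evw in TCv; apply: touch_vclosure TCv TEw.
case: (TCv) => [Iv|bv].
  exact: touch_vclosure cTC cTE (vclosure_step cTC Iv vw) TEw.
case: (TEw) => [Iw|bw].
  exact: touch_vclosure cTC cTE TCv (vclosure_step cTE Iw (adj_sym vw)).
by case: (F_indep (boundary_sub cTC bv) (boundary_sub cTE bw) vw).
Qed.

Lemma T_near_double k C D : components F C ->
  near k.*2 C D -> near k (T C) (T D).
Proof.
elim: k C => [|k IHk] C cC; first by move=> /= ->.
move=> /= [A [cA CA [B [cB AB BD]]]].
exists (T B); split; [exact: T_cell|exact: T_touch2 CA AB|exact: IHk].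
Qed.

Lemma T_near_exp n C D : components F C ->
  near (2 ^ n) C D -> near 1 (iter n T C) (iter n T D).
Proof.
elim: n C D => [//|n IHn] C D cC CD; rewrite !iterSr.
apply: IHn; first exact: T_cell.
by apply: T_near_double => //; rewrite -mul2n -expnS.
Qed.

(** * Periodic cells *)

Lemma finite_pigeonhole (U : Type) (A : set U) (u : nat -> U) :
  finite_set A -> (forall n, A (u n)) -> exists i j, i < j /\ u i = u j.
Proof.
move=> finA Au; apply: contrapT => nu; apply: infinite_nat.
have -> : [set: nat] = u @^-1` A by apply/seteqP; split=> n _ //; apply: Au.
apply: finite_preimage => // i j _ _ eu.
by case: (ltngtP i j) => // ij; case: nu; [exists i, j|exists j, i].
Qed.

Definition periodic C := exists2 m, 0 < m & iter m T C = C.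

(** If [T C] is within [d] of [C], the orbit stays within [2d] of [C], as halving brings each next
    iterate within [d] of [T C]. This ball is finite, so the orbit repeats. *)
Lemma eventually_periodic C : components F C -> exists n, periodic (iter n T C).
Proof.
move=> cC; have [d CTC] := near_connected cC (T_cell cC).
have bnd n : near d.*2 C (iter n T C).
  elim: n => [|n IHn]; first exact: near_refl.
  by rewrite -addnn; apply: near_trans CTC _; apply: T_near_double.
have [|i [j [ij eij]]] := finite_pigeonhole (u := fun n => iter n T C)
  (near_finite d.*2 cC).
  by move=> n; split=> //; apply: iter_cell.
exists i, (j - i); first by rewrite subn_gt0.
by rewrite -iterD subnK // ltnW.
Qed.

Lemma periodicM m k C : iter m T C = C -> iter (k * m) T C = C.
Proof. by move=> mC; elim: k => // k IHk; rewrite mulSn iterD IHk. Qed.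

Lemma periodic_common C D : periodic C -> periodic D -> exists2 m, 0 < m &
  iter m T C = C /\ iter m T D = D.
Proof.
move=> [m m0 mC] [k k0 kD]; exists (k * m); first by rewrite muln_gt0 k0.
by split; [apply: periodicM|rewrite mulnC; apply: periodicM].
Qed.

(** Iterating a common period fixes both cells, yet shrinks any chain between them to length one. *)
Lemma periodic_touch C D : components F C -> components F D ->
  periodic C -> periodic D -> touch C D.
Proof.
move=> cC cD pC pD; have [m m0 [mC mD]] := periodic_common pC pD.
have [k CD] := near_connected cC cD.
(* [k * m] is a multiple of the period that allows enough halvings. *)
have : near (2 ^ (k * m)) C D.
  apply: near_mono CD => //.
  exact: leq_trans (leq_pmulr k m0) (ltnW (ltn_expl _ (ltnSn 1))).
by move=> /(T_near_exp cC); rewrite !periodicM // => -[E [cE CE <-]].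
Qed.

(** With [g u] the shared vertex, each of [g a] and [g b] is equal or adjacent to [u]. Independence
    leaves [g a = u = g b], or both on the boundary of the cell of [u]; then [a] and [b] are equal,
    since they cannot be adjacent in [F]. *)
Lemma touch_rigid C D a b : components F C -> components F D -> touch C D ->
  boundary C (g (g a)) -> boundary D (g (g b)) -> F a -> F b -> a = b.
Proof.
move=> cC cD /touchP[]// u Cu Du Ca Db Fa Fb.
have via x : adj (g a) x -> boundary (component F x) (g a) /\
    components F (component F x).
  move=> ax; have nFx : ~ F x by move=> Fx; apply: F_indep ax.
  have cE := components_component nFx; split=> //.
  exact: boundary_step cE (component_refl F x) (adj_sym ax) (Fg a).
have [eau|au] := boundary_adj cC Ca Cu; have [eub|ub] := boundary_adj cD Du Db.
- by apply: g_inj; rewrite eau eub.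
- by case: (@F_indep (g a) (g b)); rewrite // eau.
- by case: (@F_indep (g a) (g b)); rewrite // -eub.
have [Ea cE] := via _ au.
have Eb := boundary_step cE (component_refl F u) ub (Fg b).
by case: (boundary_adj cE Ea Eb) => // /(F_indep Fa Fb).
Qed.

(* Distinct periodic cells have distinct images, so the vertex they share is
   carried by [phi] to a shared boundary vertex, again and again. *)
Lemma periodic_fixed C D : components F C -> components F D -> C <> D ->
  periodic C -> periodic D -> exists x, g x = x.
Proof.
move=> cC cD nCD pC pD; have [m m0 [mC mD]] := periodic_common pC pD.
have nTn n : iter n T C <> iter n T D.
  move=> e; apply: nCD; rewrite -(periodicM n mC) -(periodicM n mD).
  by rewrite -(subnK (leq_pmulr n m0)) !iterD e.
have shared n x : boundary (iter n T C) x -> boundary (iter n T D) x ->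
    exists y, [/\ g y = x, boundary (iter n.+1 T C) y
      & boundary (iter n.+1 T D) y].
  move=> bC bD; have [y ey] := F_range (boundary_sub (iter_cell n cC) bC).
  exists y; have cCn := iter_cell n.+1 cC; have cDn := iter_cell n.+1 cD.
  rewrite -ey in bC bD; have Cy := T_vclosure (iter_cell n cC) bC.
  have Dy := T_vclosure (iter_cell n cD) bD.
  by have [? ?] := vclosure_boundary cCn cDn (nTn n.+1) Cy Dy.
have [v Cv Dv] := periodic_touch cC cD pC pD.
have [v1 [e1 C1 D1]] := shared 0 v Cv Dv.
have [v2 [e2 C2 D2]] := shared 1 v1 C1 D1.
have [v3 [e3 C3 D3]] := shared 2 v2 C2 D2.
have T1 : touch C (T C).
  apply: (periodic_touch cC (T_cell cC) pC).
  by exists m => //; rewrite -iterSr iterS mC.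
(* [v = g (g v2)] and [v1 = g (g v3)] lie on the boundaries of the touching cells [C] and [T C]. *)
have e23 : v2 = v3.
  apply: (touch_rigid cC (T_cell cC) T1); rewrite ?e3 ?e2 ?e1 //.
    exact: (boundary_sub (iter_cell 2 cC) C2).
  exact: (boundary_sub (iter_cell 3 cC) C3).
by exists v2; rewrite {1}e23.
Qed.

(** * Fixed vertices of [g] *)

Lemma fixed_in_F x : g x = x -> F x.
Proof. by move=> <-. Qed.

(** A fixed vertex lies in [F], so it cannot be interior to the image cell. *)
Lemma fixed_boundary n C x : g x = x -> components F C -> boundary C x ->
  boundary (iter n T C) x.
Proof.
move=> gx cC bC; elim: n => //= n IHn; have cCn := iter_cell n cC.
have : vclosure (T (iter n T C)) x by apply: T_vclosure => //; rewrite gx.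
case=> // /(components_avoid (T_cell cCn)); case; exact: fixed_in_F.
Qed.

(** An isolated vertex would be the whole connected graph, which is infinite; a neighbour of [x]
    lies outside [F] by independence. *)
Lemma cells_at_nonempty x : F x -> exists C, cells_at x C.
Proof.
move=> Fx; have [y xy] : exists y, adj x y.
  apply: contrapT => nx; apply: X_infinite.
  apply: (@sub_finite_set _ _ [set x]); last exact: finite_set1.
  move=> y _; move: y (X_connected x y); apply: walk_ind => //= y z _ -> _ _ xz.
  by case: nx; exists z.
have nFy : ~ F y by move=> Fy; apply: F_indep xy.
have cE := components_component nFy; exists (component F y); split=> //.
exact: boundary_step cE (component_refl F y) (adj_sym xy) Fx.
Qed.

(** Iterating [T] makes a cell at [x] touch a cell at [y], while each stays at its fixed vertex;
    [touch_rigid] then applies with [a = x] and [b = y]. *)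
Lemma fixed_unique x y : g x = x -> g y = y -> x = y.
Proof.
move=> gx gy; have [Fx Fy] := (fixed_in_F gx, fixed_in_F gy).
have [[C [cC Cx]] [D [cD Dy]]] := (cells_at_nonempty Fx, cells_at_nonempty Fy).
have [k CD] := near_connected cC cD.
have := T_near_exp cC (near_mono cC (ltnW (ltn_expl k (ltnSn 1))) CD).
move=> [E [cE CE eED]]; rewrite eED in CE.
apply: (touch_rigid (iter_cell k cC) (iter_cell k cD) CE); rewrite ?gx ?gy //.
  exact: fixed_boundary.
exact: fixed_boundary.
Qed.

Lemma cell_exists : exists C, components F C.
Proof.
have [x] : [set: X] !=set0.
  by apply/set0P/eqP => X0; apply: X_infinite; rewrite X0.
by move=> _; have [C []] := cells_at_nonempty (Fg x); exists C.
Qed.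

Lemma iter_fixed n C : T C = C -> iter n T C = C.
Proof. by move=> TC; elim: n => //= n ->. Qed.

(** Finiteness gives one exponent [M] that sends all cells at [x] to [O], and the [M]-th iterate of
    [T] still reaches every cell at [x]. *)
Lemma fixed_cell_unique x O : g x = x ->
    (forall D, cells_at x D -> exists2 C, cells_at x C & T C = D) ->
    T O = O -> (forall C, components F C -> exists n, iter n T C = O) ->
  forall D, cells_at x D -> D = O.
Proof.
move=> gx T_surj TO reach D.
have [s sE] := (finite_seqP (cells_at x)).1 (cells_at_finite x).
have [N NP] : {N : set X -> nat &
    forall C, components F C -> iter (N C) T C = O}.
  apply: (choice (P := fun C n => components F C -> iter n T C = O)) => C.
  have [/reach[n nC]|nC] := pselect (components F C); first by exists n.
  (* A default for sets that are not cells. *)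
  by exists 0.
pose M := \max_(C <- s) N C.
have MP C : cells_at x C -> iter M T C = O.
  move=> xC; have sC : C \in s by have := xC; rewrite sE.
  have leM : N C <= M by apply: leq_bigmax_seq.
  by rewrite -(subnK leM) iterD NP ?iter_fixed //; case: xC.
have iter_surj n : forall D, cells_at x D ->
    exists2 C, cells_at x C & iter n T C = D.
  elim: n => [|n IHn] E xE; first by exists E.
  have [B xB <-] := T_surj E xE; have [C xC <-] := IHn B xB.
  by exists C.
by move=> /(iter_surj M)[C xC <-]; apply: MP.
Qed.

End SelfSimilar.

(** * The maps [supercell] and [phiS] *)

Section Supercells.
Variables (X : graph) (F : set X) (psi : X -> reduced F) (phi : reduced F -> X).
Implicit Types (A C D : set X).

Lemma in_set_type (x : reduced F) : F (sval x).
Proof. exact/set_mem/(svalP x). Qed.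

Lemma Fpow_sub n : Fpow psi n.+1 `<=` F.
Proof. by move=> _ [x _ <-] /=; exact: in_set_type. Qed.

Lemma components_sub G C x : G `<=` F -> components F C -> C x ->
  C `<=` component G x.
Proof.
move=> sGF cC Cx; rewrite (componentsE cC Cx) => y.
by apply: walk_mono => z nFz /sGF.
Qed.

Lemma supercell_eq C D : components F C -> components (Fpow psi 2) D ->
  C `<=` D -> supercell psi C = D.
Proof.
move=> cC cD CD; apply: xget_unique => // E [cE CE].
have [x Cx] := components_nonempty cC.
exact: components_disjoint cE cD (CE _ Cx) (CD _ Cx).
Qed.

(** As F^2 lies in [F], some 2-cell contains [C], so [xget] does not fall back on [set0]. *)
Lemma supercellP C : components F C ->
  components (Fpow psi 2) (supercell psi C) /\ C `<=` supercell psi C.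
Proof.
move=> cC; have [x Cx] := components_nonempty cC.
have CS := components_sub (@Fpow_sub 1) cC Cx.
have cS : components (Fpow psi 2) (component (Fpow psi 2) x).
  by apply: components_component => /Fpow_sub; apply: components_avoid cC Cx.
by rewrite (supercell_eq cC cS CS).
Qed.

Hypothesis psiK : cancel psi phi.
Hypothesis phiK : cancel phi psi.

Lemma phi_imageE A : phi_image phi A = [set w | A (sval (psi w))].
Proof.
apply/seteqP; split=> [_ [x Ax <-]|w Aw]; first by rewrite /= phiK.
by exists (psi w) => //=; rewrite psiK.
Qed.

(** A boundary vertex of [C] lies in F^2, hence on the boundary of the supercell, or else in the
    supercell itself. *)
Lemma phiS_vclosure C w : components F C ->
    boundary (phiS psi phi C) = phi_image phi (boundary (supercell psi C)) ->
  boundary C (sval (psi w)) -> vclosure (phiS psi phi C) w.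
Proof.
move=> cC bE [_ [c Cc cw]]; have [cS CS] := supercellP cC.
rewrite /vclosure bE /phiS !phi_imageE.
have [F2w|nF2w] := pselect (Fpow psi 2 (sval (psi w))).
  by right; apply: boundary_step cS (CS _ Cc) cw F2w.
by left; apply: components_step cS (CS _ Cc) cw nF2w.
Qed.

Lemma origin_vertexP (x : reduced F) :
  origin_vertex phi x <-> sval (psi (phi x)) = phi x.
Proof. by rewrite phiK /origin_vertex; split=> ->. Qed.

End Supercells.

Theorem theorem2p3 (X : graph) (F : set X)
    (psi : X -> reduced F) (phi : reduced F -> X)
    (X_connected : connected_graph X)
    (X_locally_finite : locally_finite X)
    (X_infinite : infinite_set [set: X])
    (X_self_similar : self_similar_by psi)
    (psiK : cancel psi phi) (phiK : cancel phi psi) :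
  (forall n : nat, 1 <= n -> self_similar (Fpow psi n)) /\
  ((forall C : set X, cell F C ->
      cell F (phiS psi phi C) /\
      boundary (phiS psi phi C) = phi_image phi (boundary (supercell psi C))) ->
   (one_origin_cell psi phi \/ one_origin_vertex psi phi) /\
   ((forall x : reduced F, origin_vertex phi x ->
       ~ exists! C : set X, cell F C /\ boundary C (sval x)) ->
    ~ (one_origin_cell psi phi /\ one_origin_vertex psi phi))).
Proof.
have [F_indep F_meet [_ psi_adj]] := X_self_similar.
pose g x := sval (psi x).
have g_inj : injective g by move=> x y /val_inj/(can_inj psiK).
have FE : F = range g.
  apply/seteqP; split=> [x Fx|_ [x _ <-]]; last exact: in_set_type.
  by exists (phi (exist _ x (mem_set Fx))) => //; rewrite /g phiK.
have adjP x y : adj x y <-> x <> y /\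
    exists2 C, components F C & boundary C (g x) /\ boundary C (g y).
  rewrite psi_adj; split=> -[nxy bxy]; split=> //.
    by move=> exy; rewrite exy in nxy.
  by move=> /(can_inj psiK).
split=> [[//|n] _|phiS_cell].
  have [Fn_indep Fn_meet Fn_adjP] :=
    range_iter_self_similar g_inj FE F_indep adjP F_meet n.
  (* The required isomorphism is the iterate of [g], with its codomain cut down to its range. *)
  pose psin x : reduced (Fpow psi n.+1) :=
    exist _ (iter n.+1 g x) (mem_set (imageT (iter n.+1 g) x)).
  have psin_inj : injective psin.
    by move=> x y [] /g_inj/(iter_inj g_inj).
  exists psin; split=> //; split=> [|x y].
    have psin_surj (z : reduced (Fpow psi n.+1)) : exists x, psin x = z.
      have [x _ ex] := in_set_type z; exists x; exact: val_inj.
    have [h hK] := choice psin_surj.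
    by exists h => // x; apply: psin_inj; rewrite hK.
  rewrite Fn_adjP; split=> -[nxy bxy]; split=> //; first by move=> /psin_inj.
  by move=> exy; rewrite exy in nxy.
pose T := phiS psi phi.
have T_cell C : components F C -> components F (T C) by case/phiS_cell.
have T_vclosure C w : components F C -> boundary C (g w) -> vclosure (T C) w.
  by move=> cC; apply: phiS_vclosure => //; case: (phiS_cell C cC).
have ev_per := eventually_periodic FE F_indep adjP X_connected X_locally_finite
  T_cell T_vclosure.
split.
  have [[C [D [cC cD nCD [pC pD]]]]|one] := pselect (exists C D,
      [/\ components F C, components F D, C <> D &
        periodic T C /\ periodic T D]).
    right; split=> [|E cE].
      have [x gx] := periodic_fixed g_inj FE F_indep adjP X_connected T_cell
        T_vclosure cC cD nCD pC pD.
      exists (psi x); split=> [|y /(origin_vertexP phiK) gy].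
        by apply/(origin_vertexP phiK); rewrite psiK.
      apply: (can_inj phiK); rewrite psiK.
      exact: (fixed_unique g_inj FE F_indep adjP X_connected X_infinite
        T_cell T_vclosure gx gy).
    have [n [m m0 mE]] := ev_per E cE.
    exists m, (iter n T E), n; split=> //; split=> //.
    exact: iter_cell.
  have {}one C D : components F C -> components F D ->
      periodic T C -> periodic T D -> C = D.
    by move=> cC cD pC pD; apply: contrapT => nCD; apply: one; exists C, D.
  left; have [C cC] := cell_exists FE F_indep X_connected X_infinite.
  have [n pO] := ev_per C cC; set O := iter n T C in pO.
  have cO : components F O by apply: iter_cell.
  exists O; split=> [|D cD].
    split=> [|D [cD TD]]; last by apply: one => //; exists 1.
    (* [T O] shares the period of [O], so uniqueness gives [T O = O]. *)
    split=> //; apply: one => //; first exact: T_cell.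
    by have [m m0 mO] := pO; exists m => //; rewrite -iterSr iterS mO.
  have [k pD] := ev_per D cD; exists k; apply: one => //; exact: iter_cell.
(* Both alternatives together would make [O] the only cell at the origin vertex, contrary to
   [many]. *)
move=> many [[O [[[cO TO] _] reach]] [[x [ox _]] _]]; apply: (many x ox).
have gx : g (sval x) = sval x.
  by have := ox; rewrite /origin_vertex => <-; rewrite /g phiK.
have onlyO D : cells_at F (sval x) D -> D = O.
  apply: (fixed_cell_unique X_locally_finite gx _ TO reach) => {}D [cD bD].
  (* To find a preimage of [D] under [T], lift [D] to the 2-cell [D2], again at the fixed vertex; a
     cell inside [D2] at this vertex has supercell [D2], hence image [D]. *)
  have [D2 [cD2 D2E bD2]] := components_lift g_inj FE F_indep adjP cD.
  have F2E : Fpow psi 2 = g @` F by rewrite [in RHS]FE image_comp.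
  rewrite -F2E in cD2.
  have b2x : boundary D2 (sval x) by rewrite bD2; exists (sval x).
  have [_ [c D2c cx]] := b2x.
  have nFc : ~ F c by move=> Fc; apply: F_indep cx => //; exact: in_set_type.
  have cC := components_component nFc.
  exists (component F c).
    split=> //; apply: boundary_step cC (component_refl F c) cx _.
    exact: in_set_type.
  rewrite /T /phiS (supercell_eq cC cD2).
    by rewrite (phi_imageE psiK phiK); apply/seteqP; split=> z /D2E.
  rewrite (componentsE cD2 D2c).
  apply: (components_sub (@Fpow_sub _ _ psi 1) cC).
  exact: component_refl.
have [C xC] := cells_at_nonempty F_indep X_connected X_infinite (in_set_type x).
exists O; rewrite -(onlyO C xC); split=> // D xD.
by rewrite (onlyO D xD) (onlyO C xC).
Qed.
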